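(* Let $\mathcal{J},\mathcal{K}$ be ideals on $\omega$. (1) If $\mathcal{I}=\mathcal{J}\otimes\mathcal{K}$ or $\mathcal{I}=\{\emptyset\}\otimes\mathcal{K}$, then $\mathfrak{b}(\mathcal{I},\mathrm{Fin},\mathrm{Fin})=\mathfrak{b}(\mathcal{K},\mathrm{Fin},\mathrm{Fin})$. (2) If $\mathcal{I}=\mathcal{J}\otimes\{\emptyset\}$, then $\mathfrak{b}(\mathcal{I},\mathrm{Fin},\mathrm{Fin})=\mathfrak{b}$.
   Context: An ideal on a countable infinite set $X$ is a family $\mathcal{I}\subseteq\mathcal{P}(X)$ closed under finite unions and subsets, containing all finite subsets, with $X\notin\mathcal{I}$; $\mathrm{Fin}$ denotes the ideal of finite subsets of the relevant set ($\omega$ or $\omega\times\omega$). $\mathfrak{b}$ is the bounding number. For $A\subseteq\omega\times\omega$, $(A)_x=\{y:(x,y)\in A\}$. For ideals $\mathcal{J},\mathcal{K}$ on $\omega$: $\mathcal{J}\otimes\mathcal{K}=\{A\subseteq\omega^2:\{x:(A)_x\notin\mathcal{K}\}\in\mathcal{J}\}$, $\mathcal{J}\otimes\{\emptyset\}=\{A\subseteq\omega^2:\{x:(A)_x\ne\emptyset\}\in\mathcal{J}\}$, $\{\emptyset\}\otimes\mathcal{K}=\{A\subseteq\omega^2:(A)_x\in\mathcal{K}\text{ for all }x\}$. For an ideal $\mathcal{K}$ on $X$, $\widehat{\mathcal{P}}_{\mathcal{K}}$ is the family of sequences $\langle A_n:n\in\omega\rangle$ of pairwise disjoint members of $\mathcal{K}$,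 and $\mathcal{P}_{\mathcal{K}}$ those with union $X$. For ideals on $X$: $\mathfrak{b}(\mathcal{I},\mathcal{J},\mathcal{K})=\min\{|\mathcal{E}|:\mathcal{E}\subseteq\widehat{\mathcal{P}}_{\mathcal{K}},\ \forall\langle A_n\rangle\in\mathcal{P}_{\mathcal{J}}\ \exists\langle E_n\rangle\in\mathcal{E}\ \bigcup_n(A_n\cap\bigcup_{i\le n}E_i)\notin\mathcal{I}\}$, with $\min\emptyset=\mathfrak{c}^+$. *)

(* Defs.v *)
From HB Require Import structures.
From mathcomp Require Import all_boot.
From mathcomp Require Import boolp classical_sets functions cardinality.

Set Implicit Arguments.
Unset Strict Implicit.
Unset Printing Implicit Defensive.

Local Open Scope classical_set_scope.
Local Open Scope card_scope.

(** ** Minimal cardinalities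

  A cardinal number is represented by a set of that cardinality, and equality
  of cardinals is the library's equipotence [#=]. *)

(* A member of [W] of least cardinality; cf. [min_cardP]. When [W] is empty
   the value [set0] is meaningless. *)
Definition min_card (T : Type) (W : set (set T)) : set T :=
  xget set0 [set E | W E /\ forall E', W E' -> E #<= E'].

(* Cardinals are well-ordered. Take a maximal set [F] of choice functions on
   [W] on which every evaluation [f |-> f E], [E] in [W], is injective; some
   evaluation is then onto. *)
Lemma exists_min_card (T : Type) (W : set (set T)) : W !=set0 ->
  exists2 E, W E & forall E', W E' -> E #<= E'.
Proof.
move=> [E0 WE0].
have [W0|nW0] := pselect (W set0).
  by exists set0 => // E' _; exact: subset_card_le.
have neW E : W E -> E !=set0.
  by move=> WE; apply/set0P/negP => /eqP E00; apply: nW0; rewrite -E00.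
pose P (F : set (set T -> T)) := forall E, W E ->
  (forall f, F f -> E (f E)) /\ (forall f g, F f -> F g -> f E = g E -> f = g).
have [F [PF maxF]] : exists A, P A /\ forall B, A `<` B -> ~ P B.
  apply: Zorn_bigcup => C CP totC E WE; split=> [f [X CX Xf]|f g [X CX Xf] [Y CY Yg]].
    by have [+ _] := CP X CX E WE; exact.
  have [XY|YX] := totC X Y CX CY.
    by have [_ +] := CP Y CY E WE; apply=> //; exact: XY.
  by have [_ +] := CP X CX E WE; apply=> //; exact: YX.
have [E WE onto] : exists2 E, W E & forall x, E x -> exists2 f, F f & f E = x.
  apply: contrapT => noE.
  have h E : exists x, W E -> E x /\ forall f, F f -> f E <> x.
    have [WE|nWE] := pselect (W E); last first.
      by have [x _] := neW _ WE0; exists x => /nWE.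
    apply: contrapT => nx; apply: noE; exists E => // x Ex.
    apply: contrapT => nf; apply: nx; exists x => _; split=> // f Ff fE.
    by apply: nf; exists f.
  have [g gP] := choice h.
  apply: (maxF (F `|` [set g])).
    split=> [f Ff|]; first by left.
    by move=> /(_ g (or_intror erefl)) Fg; have [_ /(_ g Fg)] := gP E0 WE0.
  move=> E WE; have [gE gF] := gP E WE; have [FE Finj] := PF E WE.
  split=> [f [/FE //|-> //]|f k [Ff|->] [Fk|->]] //.
  - exact: Finj.
  - by move=> fgE; case: (gF f Ff).
  - by move=> gkE; case: (gF k Fk).
exists E => // E' WE'.
have [x0 _] := neW E WE.
have h x : exists f, E x -> F f /\ f E = x.
  have [/onto[f Ff fE]|nEx] := pselect (E x); first by exists f.
  by exists (fun=> x0) => /nEx.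
have [s sP] := choice h.
have [FE' Finj'] := PF E' WE'.
have sinj : set_inj E (fun x => s x E').
  move=> x y; rewrite !inE => Ex Ey sxy.
  have [Fx <-] := sP x Ex; have [Fy <-] := sP y Ey.
  by rewrite (Finj' _ _ Fx Fy sxy).
have sfun : set_fun E E' (fun x => s x E').
  by move=> x Ex; apply: FE'; have [] := sP x Ex.
have [j ji] := Pinj sinj; rewrite ji in sfun.
by have [i _] := injPfun sfun; exact: inj_card_le.
Qed.

Lemma min_cardP (T : Type) (W : set (set T)) : W !=set0 ->
  W (min_card W) /\ forall E, W E -> min_card W #<= E.
Proof.
move=> /exists_min_card[E WE minE].
exact: (@xgetPex _ set0 [set E | W E /\ forall E', W E' -> E #<= E']
  (ex_intro _ E (conj WE minE))).
Qed.

(* The successor of the continuum: the least cardinality of a subset of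
   P(P(omega)) exceeding that of P(omega). *)
Definition continuum_succ : set (set (set nat)) :=
  min_card [set k : set (set (set nat)) | ~~ (k #<= [set: set nat])].

(* Cantor's theorem, so that [min_cardP] applies to [continuum_succ]. *)
Lemma gt_continuum_nonempty :
  [set k : set (set (set nat)) | ~~ (k #<= [set: set nat])] !=set0.
Proof.
exists setT; apply/negP => /pcard_leP[f].
pose D := [set x : set nat | exists2 A : set (set nat), f A = x & ~ A x].
have nD : ~ D (f D).
  move=> DfD; have [A fAD nA] := DfD; apply: nA.
  suff -> : A = D by [].
  by apply: ('inj_f); rewrite ?inE.
by apply: (nD); exists D.
Qed.

(** ** Ideals *)

Record is_ideal (X : Type) (I : set (set X)) : Prop := IsIdeal {
  ideal_setU : forall A B, I A -> I B -> I (A `|` B);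
  ideal_subset : forall A B, A `<=` B -> I B -> I A;
  ideal_finite : forall A, finite_set A -> I A;
  ideal_proper : ~ I setT }.

Definition Fin (X : Type) : set (set X) := [set A | finite_set A].
Arguments Fin {X}.

Definition ideal_prod (J K : set (set nat)) : set (set (nat * nat)) :=
  [set A | J [set x | ~ K (xsection A x)]].

Definition ideal_prod_empty (J : set (set nat)) : set (set (nat * nat)) :=
  [set A | J [set x | xsection A x <> set0]].

Definition empty_prod_ideal (K : set (set nat)) : set (set (nat * nat)) :=
  [set A | forall x, K (xsection A x)].

(** ** Cardinal invariants *)

Definition Phat (X : Type) (K : set (set X)) : set (nat -> set X) :=
  [set A | (forall n, K (A n)) /\ trivIset setT A].

Definition Ppart (X : Type) (K : set (set X)) : set (nat -> set X) :=
  [set A | Phat K A /\ \bigcup_n A n = setT].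

Definition b_witness (X : Type) (I J K : set (set X)) :
    set (set (nat -> set X)) :=
  [set E | E `<=` Phat K /\ forall A, Ppart J A -> exists2 B, E B &
    ~ I (\bigcup_n (A n `&` \bigcup_(i in [set i | (i <= n)%N]) B i))].

(* The sum type only serves to give both cases a common type. *)
Definition b_ideal (X : Type) (I J K : set (set X)) :
    set ((nat -> set X) + set (set nat)) :=
  if pselect (b_witness I J K !=set0)
  then inl @` min_card (b_witness I J K)
  else inr @` continuum_succ.

Definition eventually_le (f g : nat -> nat) : Prop :=
  finite_set [set n | ~~ (f n <= g n)%N].

Definition bounding_number : set (nat -> nat) :=
  min_card [set F : set (nat -> nat) |
    ~ exists g, forall f, F f -> eventually_le f g].

Lemma unbounded_nonempty :
  [set F : set (nat -> nat) |
    ~ exists g, forall f, F f -> eventually_le f g] !=set0.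
Proof.
exists setT => -[g /(_ (fun n => (g n).+1) I)]; rewrite /eventually_le.
have -> : [set n | ~~ ((g n).+1 <= g n)%N] = setT.
  by apply/seteqP; split=> // n _ /=; rewrite ltnn.
exact: infinite_nat.
Qed.

(* Main.v *)
Require Import Defs.
From mathcomp Require Import all_boot.
From mathcomp Require Import boolp classical_sets functions cardinality.

Set Implicit Arguments.
Unset Strict Implicit.

Local Open Scope classical_set_scope.
Local Open Scope card_scope.

(** A partition into finite sets is a finite-to-one function [a], and a disjoint
  sequence of finite sets is a partial finite-to-one function [e]; a family of
  such [e] is a witness for [b(I, Fin, Fin)] when every [a] admits some [e] in
  the family with [{e <= a}] not in [I]. Every inequality between cardinals
  follows by mapping witnesses to witnesses elementwise.
  - From [K] to [J (x) K]: replace [e] by [max(x, e(y))]; given [a] on the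
    square, catch [y |-> min_(x <= y) a(x, y)], which is finite-to-one.
  - From [{0} (x) K] to [K]: replace [e] by [y |-> min_x e(x, y)], which is
    again finite-to-one; given [a], use [max(x, a(y))].
  - From [b] to [J (x) {0}]: replace [f] by the [e] with value [n] at the points
    [(x, <n, f n>)], [x <= n]. If [f] infinitely often exceeds a function
    depending on [a], then [{e <= a}] meets every column.
  - From any [I] containing [Fin] to [b]: replace [e] by the growth of its
    sublevel sets; a bound [g] for these yields [a], an inverse of [g], with
    each [{e <= a}] finite. *)

(** * Witnesses in terms of finite-to-one functions *)

Lemma min_card_le_image (T U : Type) (phi : U -> T) (W1 : set (set T))
    (W2 : set (set U)) :
  W2 !=set0 -> (forall E, W2 E -> W1 (phi @` E)) ->
  min_card W1 #<= min_card W2.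
Proof.
move=> /min_cardP[W2m _] phiW.
have W1m := phiW _ W2m.
have [_ /(_ _ W1m) le1] := min_cardP (ex_intro W1 _ W1m).
exact: card_le_trans le1 (card_image_le _ _).
Qed.

Definition finite_fibers {X : Type} (a : X -> nat) : Prop :=
  forall n, finite_set (a @^-1` [set n]).

(** The set [{e <= a}], with [e] given by its level sets [B i]. *)
Definition below {X : Type} (a : X -> nat) (B : nat -> set X) : set X :=
  [set x | exists2 i, (i <= a x)%N & B i x].

Lemma finite_fibers_le {X : Type} (a : X -> nat) : finite_fibers a ->
  forall n, finite_set [set x | (a x <= n)%N].
Proof.
move=> fa n.
have -> : [set x | (a x <= n)%N] = \bigcup_(i in `I_n.+1) (a @^-1` [set i]).
  apply/seteqP; split=> x /=; first by move=> axn; exists (a x).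
  by move=> [i /= + ai]; rewrite /= ai ltnS.
by apply: bigcup_finite => // i _; exact: fa.
Qed.

Lemma Ppart_FinP {X : Type} (A : nat -> set X) :
  Ppart Fin A <->
  exists2 a : X -> nat, finite_fibers a & A = fun n => a @^-1` [set n].
Proof.
split=> [[[finA disjA] covA]|[a fa ->]].
  have /choice[a aP] x : exists n, A n x.
    by have : setT x by []; rewrite -covA => -[n _ Anx]; exists n.
  have Aa : A = fun n => a @^-1` [set n].
    apply/funext => n; apply/seteqP; split=> x /=; last by move=> <-; exact: aP.
    by move=> Anx; apply: (disjA _ _ I I); exists x; split=> //; exact: aP.
  by exists a => // n; have := finA n; rewrite Aa.
split; last by apply/seteqP; split=> // x _; exists (a x).
by split=> // i j _ _ [x [/= <- <-]].
Qed.

Lemma bigcup_belowE {X : Type} (a : X -> nat) (B : nat -> set X) :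
  \bigcup_n (a @^-1` [set n] `&` \bigcup_(i in [set i | (i <= n)%N]) B i) =
  below a B.
Proof.
apply/seteqP; split=> x; first by move=> [n _ [/= <- [i]]]; exists i.
by move=> [i lei Bi]; exists (a x) => //; split=> //; exists i.
Qed.

Lemma b_witnessP {X : Type} (I : set (set X)) (E : set (nat -> set X)) :
  b_witness I Fin Fin E <->
  E `<=` Phat Fin /\ forall a, finite_fibers a ->
    exists2 B, E B & ~ I (below a B).
Proof.
split=> -[EP EI]; split=> //.
  move=> a fa; have [|B EB] := EI (fun n => a @^-1` [set n]).
    by apply/Ppart_FinP; exists a.
  by rewrite bigcup_belowE; exists B.
move=> _ /Ppart_FinP[a fa ->]; have [B EB IB] := EI a fa.
by exists B; rewrite ?bigcup_belowE.
Qed.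

(** All of [Phat Fin] is a witness, because a partition catches itself: the union in question is
    then the whole set. This rules out the default value [continuum_succ]. *)
Lemma b_witness_nonempty {X : Type} (I : set (set X)) :
  ~ I setT -> b_witness I Fin Fin !=set0.
Proof.
move=> IT; exists (Phat Fin); split=> // A [PA covA]; exists A => //.
suff -> : \bigcup_n (A n `&` \bigcup_(i in [set i | (i <= n)%N]) A i) = setT by [].
apply/seteqP; split=> // x _.
have : setT x by []; rewrite -[X in X x]covA => -[n _ Anx].
by exists n => //; split=> //; exists n => /=.
Qed.

Lemma b_ideal_min_card {X : Type} (I : set (set X)) :
  ~ I setT -> b_ideal I Fin Fin #= min_card (b_witness I Fin Fin).
Proof.
move=> /b_witness_nonempty Ine; have -> : b_ideal I Fin Fin = inl @` min_card (b_witness I Fin Fin).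
  by rewrite /b_ideal; case: pselect.
by apply: inj_card_eq => x y _ _ [].
Qed.

(** * Ideals on the square *)

Lemma ideal_prod_proper (J K : set (set nat)) :
  is_ideal J -> is_ideal K -> ~ ideal_prod J K setT.
Proof.
move=> hJ hK; rewrite /ideal_prod /=.
suff -> : [set x : nat | ~ K (xsection setT x)] = setT.
  exact: ideal_proper hJ.
apply/seteqP; split=> // x _ /=.
suff -> : xsection (@setT (nat * nat)) x = setT by exact: ideal_proper hK.
by apply/seteqP; split=> // y _; rewrite /xsection /= inE.
Qed.

Lemma empty_prod_ideal_sub (J K : set (set nat)) :
  is_ideal J -> empty_prod_ideal K `<=` ideal_prod J K.
Proof.
move=> hJ A KA; rewrite /ideal_prod /=.
suff -> : [set x | ~ K (xsection A x)] = set0.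
  by apply: ideal_finite hJ _ _; exact: finite_set0.
by apply/seteqP; split=> // x /= /(_ (KA x)).
Qed.

Lemma ideal_prod_empty_proper (J : set (set nat)) :
  is_ideal J -> ~ ideal_prod_empty J setT.
Proof.
move=> hJ; rewrite /ideal_prod_empty /=.
suff -> : [set x | xsection (@setT (nat * nat)) x <> set0] = setT.
  exact: ideal_proper hJ.
apply/seteqP; split=> // x _ /= s0.
have : xsection (@setT (nat * nat)) x 0 by rewrite /xsection /= inE.
by rewrite s0.
Qed.

Lemma ideal_prod_empty_finite (J : set (set nat)) (A : set (nat * nat)) :
  is_ideal J -> finite_set A -> ideal_prod_empty J A.
Proof.
move=> hJ finA; apply: ideal_finite hJ _ _.
apply: sub_finite_set (finite_image fst finA) => x /= /eqP/set0P[y].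
by rewrite /xsection /= inE => Axy; exists (x, y).
Qed.

Lemma b_witness_anti {X : Type} (I I' : set (set X)) :
  I' `<=` I -> b_witness I Fin Fin `<=` b_witness I' Fin Fin.
Proof.
move=> sub E [EP EI]; split=> // A /EI[B EB IB]; exists B => //.
by move=> /sub.
Qed.

(** * From witnesses for [K] to witnesses for the product *)

(** Level sets of [max(x, e(y))]. The maximum with [x] keeps them finite although every column
    carries a copy of the domain of [e]. *)
Definition max_lift (B : nat -> set nat) (n : nat) : set (nat * nat) :=
  [set z | exists2 i, B i z.2 & maxn z.1 i = n].

Lemma max_lift_Phat (B : nat -> set nat) :
  Phat Fin B -> Phat Fin (max_lift B).
Proof.
move=> [finB disjB]; split=> [n|m n _ _ [[x y] [[i /= Bi <-] [j /= Bj <-]]]].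
  apply: (@sub_finite_set _ _ (`I_n.+1 `*` \bigcup_(i in `I_n.+1) B i)).
    move=> [x y] [i /= Bi <-]; split=> /=; first by rewrite ltnS leq_maxl.
    by exists i => //=; rewrite ltnS leq_maxr.
  by apply: finite_setX => //; apply: bigcup_finite => // i _; exact: finB.
by rewrite (disjB i j) //; exists y.
Qed.

(** The minimum over [x <= y] is attained at some [(s y, y)], so a fiber of [b] lies in the second
    projection of a fiber of [a]. *)
Lemma column_min (a : nat * nat -> nat) : finite_fibers a ->
  exists2 b : nat -> nat, finite_fibers b &
    forall x y, (x <= y)%N -> (b y <= a (x, y))%N.
Proof.
move=> fa.
have /choice[s sP] y : exists x, forall x', (x' <= y)%N -> (a (x, y) <= a (x', y))%N.
  have [i _ iP] := @arg_minnP _ (@ord0 y) xpredT (fun i => a (val i, y)) isT.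
  by exists (val i) => x' lex; exact: (iP (Ordinal (lex : x' < y.+1)%N)).
exists (fun y => a (s y, y)) => [n|x y]; last exact: sP.
apply: sub_finite_set (finite_image snd (fa n)) => y /= asy.
by exists (s y, y).
Qed.

Lemma b_witness_max_lift (J K : set (set nat)) (E : set (nat -> set nat)) :
  is_ideal J -> is_ideal K -> b_witness K Fin Fin E ->
  b_witness (ideal_prod J K) Fin Fin (max_lift @` E).
Proof.
move=> hJ hK /b_witnessP[EP EK]; apply/b_witnessP; split.
  by move=> _ [B /EP PB <-]; exact: max_lift_Phat.
move=> a fa; have [b fb ba] := column_min fa; have [B EB KB] := EK b fb.
exists (max_lift B); first by exists B.
rewrite /ideal_prod /=.
suff -> : [set x | ~ K (xsection (below a (max_lift B)) x)] = setT.
  exact: ideal_proper hJ.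
apply/seteqP; split=> // x _ /= Kx; apply: KB.
(* The exceptional points of column [x]: those with [y < x], where [b y] need not be below
   [a (x, y)], and those where [a] may not exceed [x]. Off this finite set, [e(y) <= b y] implies
   [max(x, e(y)) <= a (x, y)]. *)
pose S := `I_x `|` snd @` [set z | (a z <= x)%N].
apply: (ideal_subset hK (B := xsection (below a (max_lift B)) x `|` S)).
  move=> y [i lei Bi]; have [Sy|nSy] := pselect (S y); [by right|left].
  rewrite /xsection /= inE; exists (maxn x i); last by exists i.
  have xy : (x <= y)%N by rewrite leqNgt; apply/negP => yx; apply: nSy; left.
  rewrite geq_max (leq_trans lei (ba _ _ xy)) andbT leqNgt; apply/negP => axy.
  by apply: nSy; right; exists (x, y) => //=; exact: ltnW.
apply: (ideal_setU hK Kx); apply: (ideal_finite hK).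
rewrite finite_setU; split=> //; apply: finite_image; exact: finite_fibers_le.
Qed.

(** * From witnesses on the square to witnesses for [K] *)

(** Level sets of the minimum of [e(x, y)] over [x]; keeping only the least index makes them
    disjoint. *)
Definition min_proj (B : nat -> set (nat * nat)) (n : nat) : set nat :=
  [set y | (snd @` B n) y /\ forall i, (i < n)%N -> ~ (snd @` B i) y].

Lemma min_proj_Phat (B : nat -> set (nat * nat)) :
  Phat Fin B -> Phat Fin (min_proj B).
Proof.
move=> [finB _]; split=> [n|i j _ _ [y [[Bi ltB] [Bj ltB']]]].
  by apply: sub_finite_set (finite_image snd (finB n)) => y [].
by have [/ltB'|/ltB|] := ltngtP i j.
Qed.

Lemma min_projP (B : nat -> set (nat * nat)) (i : nat) (z : nat * nat) :
  B i z -> exists2 j, (j <= i)%N & min_proj B j z.2.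
Proof.
move=> Bi; have ex : exists j, `[< (snd @` B j) z.2 >].
  by exists i; apply/asboolP; exists z.
have [j /asboolP Bj jmin] := ex_minnP ex.
exists j; first by apply: jmin; apply/asboolP; exists z.
by split=> // k kj Bk; have := jmin k (asboolT Bk); rewrite leqNgt kj.
Qed.

Lemma b_witness_min_proj (K : set (set nat)) (E : set (nat -> set (nat * nat))) :
  is_ideal K -> b_witness (empty_prod_ideal K) Fin Fin E ->
  b_witness K Fin Fin (min_proj @` E).
Proof.
move=> hK /b_witnessP[EP EK]; apply/b_witnessP; split.
  by move=> _ [B /EP PB <-]; exact: min_proj_Phat.
move=> a fa.
have [|B EB KB] := EK (fun z => maxn z.1 (a z.2)).
  move=> n; apply: (@sub_finite_set _ _ (`I_n.+1 `*` [set y | (a y <= n)%N])).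
    by move=> [x y] /= <-; split=> /=; rewrite ?ltnS ?leq_maxl ?leq_maxr.
  by apply: finite_setX => //; exact: finite_fibers_le.
exists (min_proj B); first by exists B.
move=> Ka; apply: KB => x.
(* In column [x], [max(x, a y)] equals [a y] except at the finitely many [y] with [a y <= x]. *)
apply: (ideal_subset hK (B := below a (min_proj B) `|` [set y | (a y <= x)%N])).
  move=> y; rewrite /xsection /= inE => -[i lei Bi].
  have [ayx|xay] := leqP (a y) x; [by right|left].
  have [j ji Bj] := min_projP Bi; exists j => //.
  by move: lei => /=; rewrite (maxn_idPr (ltnW xay)); exact: leq_trans.
apply: (ideal_setU hK Ka); apply: (ideal_finite hK).
exact: finite_fibers_le.
Qed.

(** * The lower bound by the bounding number *)

(* The summand [m] makes the bound unbounded, so that a minimum exists. *)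
Lemma slow_inverse_subproof {X : countType} (h : nat -> nat) (x : X) :
  exists m, (pickle x <= h m + m)%N.
Proof. by exists (pickle x); rewrite leq_addl. Qed.

Definition slow_inverse {X : countType} (h : nat -> nat) (x : X) : nat :=
  ex_minn (slow_inverse_subproof h x).

Lemma finite_pickle_le {X : countType} (n : nat) :
  finite_set [set x : X | (pickle x <= n)%N].
Proof.
have := @finite_preimage _ _ `I_n.+1 (@pickle X).
by apply => // x y _ _; exact: (pcan_inj pickleK).
Qed.

Lemma slow_inverse_fibers {X : countType} (h : nat -> nat) :
  finite_fibers (@slow_inverse X h).
Proof.
move=> n; apply: sub_finite_set (finite_pickle_le (h n + n)) => x /= <-.
by rewrite /slow_inverse; case: ex_minnP.
Qed.

Lemma lt_slow_inverse {X : countType} (h : nat -> nat) (m : nat) (x : X) :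
  (m < slow_inverse h x -> h m < pickle x)%N.
Proof.
rewrite /slow_inverse; case: ex_minnP => k _ kmin mk.
rewrite ltnNge; apply/negP => xm.
by have := kmin m (leq_trans xm (leq_addr _ _)); rewrite leqNgt mk.
Qed.

Lemma finite_nat_bound {A : set nat} :
  finite_set A -> exists n, forall k, A k -> (k <= n)%N.
Proof.
move=> /finite_seqP[s ->]; exists (\max_(i <- s) i) => k /= ks.
exact: (@leq_bigmax_seq _ s xpredT id).
Qed.

(** The condition [Phat Fin B] stands under the existential so that choice turns [r] into a total
    function of [B], to be used as the map on witnesses. *)
Lemma reach_exists {X : countType} (B : nat -> set X) :
  exists r : nat -> nat, Phat Fin B ->
    forall m i x, (i <= m.+1)%N -> B i x -> (pickle x <= r m)%N.
Proof.
have [[finB _]|nB] := pselect (Phat Fin B); last by exists id => /nB.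
suff /choice[r rP] : forall m, exists n, forall i x,
    (i <= m.+1)%N -> B i x -> (pickle x <= n)%N by exists r.
move=> m.
have [|n nP] := @finite_nat_bound (pickle @` \bigcup_(i in `I_m.+2) B i).
  by apply: finite_image; apply: bigcup_finite => // i _; exact: finB.
by exists n => i x im Bi; apply: nP; exists x => //; exists i.
Qed.

(** If [x] is in the set and its slow inverse is [m.+1], then [g m < pickle x <= r m], which bounds
    [m]. So the slow inverse is bounded on the set, and it has finite fibers. The shift to [m.+1] in
    [r] is what makes the two estimates meet at the same [m]. *)
Lemma below_slow_inverse_finite {X : countType} (B : nat -> set X)
    (r g : nat -> nat) :
  (forall m i x, (i <= m.+1)%N -> B i x -> (pickle x <= r m)%N) ->
  eventually_le r g -> finite_set (below (slow_inverse g) B).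
Proof.
move=> rP /finite_nat_bound[N NP].
apply: sub_finite_set (finite_fibers_le (@slow_inverse_fibers X g) N.+1).
move=> x [i /= + Bi]; case E: (slow_inverse g x) => [//|m] im.
rewrite ltnS; apply: NP => /=; rewrite -ltnNge.
apply: (@leq_trans (pickle x)); last exact: rP im Bi.
by apply: lt_slow_inverse; rewrite E.
Qed.

Lemma bounding_le_min_card_witness {X : countType} (I : set (set X)) :
  ~ I setT -> Fin `<=` I -> bounding_number #<= min_card (b_witness I Fin Fin).
Proof.
move=> IT FinI; have [r rP] := choice (@reach_exists X).
apply: (@min_card_le_image _ _ r); first exact: b_witness_nonempty.
move=> E /b_witnessP[EP EI] /= [g gP].
have [B EB] := EI _ (@slow_inverse_fibers X g); apply.
apply: FinI; apply: (@below_slow_inverse_finite _ _ (r B)).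
  exact/rP/EP.
by apply: gP; exists B.
Qed.

(** * From unbounded families to witnesses *)

(** Coding [n] together with [f n] makes the blocks disjoint. The cut [x <= n] makes them finite,
    yet column [x] meets every block from [n = x] on. *)
Definition graph_blocks (f : nat -> nat) (n : nat) : set (nat * nat) :=
  [set z | (z.1 <= n)%N /\ z.2 = pickle (n, f n)].

Lemma graph_blocks_Phat (f : nat -> nat) : Phat Fin (graph_blocks f).
Proof.
split=> [n|m n _ _ [[x y] [[/= _ ->] [/= _ /(pcan_inj pickleK)[]]]]] //.
apply: (@sub_finite_set _ _ (`I_n.+1 `*` [set pickle (n, f n)])).
  by move=> [x y] [].
by apply: finite_setX.
Qed.

(** For fixed [n], the finitely many points where [a] is at most [n] involve only finitely many [m],
    so one threshold serves all [x]. *)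
Lemma graph_blocks_threshold (a : nat * nat -> nat) : finite_fibers a ->
  exists g : nat -> nat, forall n x m,
    (g n < m)%N -> (n <= a (x, pickle (n, m)))%N.
Proof.
move=> fa.
suff /choice[g gP] : forall n, exists N, forall x m,
    (N < m)%N -> (n <= a (x, pickle (n, m)))%N by exists g.
move=> n; pose S := [set m : nat | exists2 z : nat * nat, (a z <= n)%N & z.2 = pickle (n, m)].
have [|N NP] := @finite_nat_bound S.
  have inj : {in (fun m => pickle (n, m)) @^-1` (snd @` [set z | (a z <= n)%N]) &,
      injective (fun m : nat => pickle (n, m))}.
    by move=> m m' _ _ /(pcan_inj pickleK)[].
  apply: sub_finite_set (finite_preimage inj _).
    by move=> m [z az zE]; exists z.
  by apply: finite_image; exact: finite_fibers_le.
exists N => x m; rewrite ltnNge => /negP Nm.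
rewrite leqNgt; apply/negP => /ltnW an; apply: Nm; apply: NP.
by exists (x, pickle (n, m)).
Qed.

Lemma b_witness_graph_blocks (J : set (set nat)) (F : set (nat -> nat)) :
  is_ideal J -> (~ exists g, forall f, F f -> eventually_le f g) ->
  b_witness (ideal_prod_empty J) Fin Fin (graph_blocks @` F).
Proof.
move=> hJ unbF; apply/b_witnessP; split.
  by move=> _ [f _ <-]; exact: graph_blocks_Phat.
move=> a /graph_blocks_threshold[g gP].
have [f Ff nfg] : exists2 f, F f & ~ eventually_le f g.
  apply: contrapT => nof; apply: unbF; exists g => f Ff.
  by apply: contrapT => nfg; apply: nof; exists f.
exists (graph_blocks f); first by exists f.
rewrite /ideal_prod_empty /=.
suff -> : [set x | xsection (below a (graph_blocks f)) x <> set0] = setT.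
  exact: ideal_proper hJ.
apply/seteqP; split=> // x _ /=.
(* [f] exceeds [g] infinitely often, hence at some [n >= x], whose block meets column [x]. *)
have [n xn gfn] : exists2 n, (x <= n)%N & (g n < f n)%N.
  apply: contrapT => non; apply: nfg.
  apply: (@sub_finite_set _ _ `I_x) => // n /=; rewrite -ltnNge => gfn.
  by rewrite ltnNge; apply/negP => xn; apply: non; exists n.
apply/eqP/set0P; exists (pickle (n, f n)); rewrite /xsection /= inE.
by exists n => //; exact: gP.
Qed.

Theorem theorem5p9 (J K : set (set nat)) (hJ : is_ideal J) (hK : is_ideal K) :
  (forall I : set (set (nat * nat)),
      I = ideal_prod J K \/ I = empty_prod_ideal K ->
      b_ideal I Fin Fin #= b_ideal K Fin Fin)
  /\
  (forall I : set (set (nat * nat)),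
      I = ideal_prod_empty J ->
      b_ideal I Fin Fin #= bounding_number).
Proof.
split=> [I IE|I ->].
  (* Both ideals lie between these two, and a witness for an ideal is one for any smaller ideal, so
     each inequality is needed at one end only. *)
  have [subI Isub] : I `<=` ideal_prod J K /\ empty_prod_ideal K `<=` I.
    by case: IE => ->; split=> //; exact: empty_prod_ideal_sub.
  have IT : ~ I setT by move=> /subI; exact: ideal_prod_proper.
  have KT := ideal_proper hK.
  apply: card_eq_trans (b_ideal_min_card IT) _.
  rewrite card_eq_sym; apply: card_eq_trans (b_ideal_min_card KT) _.
  rewrite card_eq_le; apply/andP; split.
    apply: (@min_card_le_image _ _ min_proj); first exact: b_witness_nonempty.
    by move=> E /(b_witness_anti Isub); exact: b_witness_min_proj.
  apply: (@min_card_le_image _ _ max_lift); first exact: b_witness_nonempty.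
  by move=> E /(b_witness_max_lift hJ hK); exact: b_witness_anti.
have IT := @ideal_prod_empty_proper J hJ.
apply: card_eq_trans (b_ideal_min_card IT) _.
rewrite card_eq_le; apply/andP; split.
  apply: (@min_card_le_image _ _ graph_blocks); first exact: unbounded_nonempty.
  by move=> F; exact: b_witness_graph_blocks.
by apply: bounding_le_min_card_witness => // A; exact: ideal_prod_empty_finite.
Qed.
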